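(* Let $s,l,m,\delta_1,\delta_2$ be Lax data on $\mathbb{Z}^2$ (as defined in the context) whose Lax matrices $L,M$ satisfy the integrability condition $M_1L=L_2M$ for all $\lambda>0$. Let $\Phi=\Phi(k,\ell,\lambda)$ be a solution of $$\Phi_1=L\Phi,\qquad \Phi_2=M\Phi$$ with values in the nonzero quaternions, depending smoothly on $\lambda=e^t$. Then for each $t\in\mathbb{R}$ the maps $f:\mathbb{Z}^2\to\mathbb{R}^3$ and $n:\mathbb{Z}^2\to\mathbb{S}^2$ given by $$f=2\left[\Phi^{-1}\frac{\partial}{\partial t}\Phi\right]^{\mathrm{tr}=0},\qquad n=-i\,\Phi^{-1}\sigma_3\Phi,\qquad \lambda=e^t,$$ form an edge-constraint net.
   Context: Quaternions: $\mathbb{H}$ is the real span of the $2\times2$ matrices $\mathbb{1},-i\sigma_1,-i\sigma_2,-i\sigma_3$, where $\sigma_1=\begin{pmatrix}0&1\\1&0\end{pmatrix}$, $\sigma_2=\begin{pmatrix}0&-i\\i&0\end{pmatrix}$, $\sigma_3=\begin{pmatrix}1&0\\0&-1\end{pmatrix}$. $\mathbb{R}^3$ is identified with the imaginary (trace-free) quaternions by $(x_1,x_2,x_3)\leftrightarrow\sum_j x_j(-i\sigma_j)$, and $[X]^{\mathrm{tr}=0}$ is the trace-free part of $X\in\mathbb{H}$. Shift notation: for a map $g$ on $\mathbb{Z}^2$, $g=g(k,\ell)$, $g_1=g(k+1,\ell)$, $g_2=g(k,\ell+1)$, $g_{12}=g(k+1,\ell+1)$. (For $\delta_1,\delta_2$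 the index is a label, not a shift.) Lax data: a function $s:\mathbb{Z}^2\to\{z\in\mathbb{C}:|z|=1\}$ on vertices; nonzero complex functions $l$ and $m$ on the edges in the first and second lattice direction ($l(k,\ell)$ sits on the edge from $(k,\ell)$ to $(k+1,\ell)$, $m(k,\ell)$ on the edge from $(k,\ell)$ to $(k,\ell+1)$); parameters $\delta_1$ (constant in the second lattice direction) and $\delta_2$ (constant in the first lattice direction), each of which is either real (with $\tan\frac{\delta_i}2\ne0$ finite) or complex with $\sin\delta_i$ real and $>1$ (in which case $|\tan\frac{\delta_i}{2}|=1$). All these are independent of the spectral parameter $\lambda=e^t>0$. The Lax matrices are $$L=\begin{pmatrix}\cot\frac{\delta_1}2\frac{l}{s}+\tan\frac{\delta_1}2\,l s_1& i(\lambda-\frac{ss_1}{\lambda})\\ i(\lambda-\frac{1}{\lambda ss_1})&\cot\frac{\delta_1}2\frac{s}{l}+\tan\frac{\delta_1}2\frac{1}{l s_1}\end{pmatrix},\quad M=\begin{pmatrix}\cot\frac{\delta_2}2\frac{m}{s}+\tan\frac{\delta_2}2\,m s_2& i(\lambda-\frac{ss_2}{\lambda})\\ i(\lambda-\frac{1}{\lambda ss_2})&\cot\frac{\delta_2}2\frac{s}{m}+\tan\frac{\delta_2}2\frac{1}{m s_2}\end{pmatrix}.$$ The moduli of $l,m$ are required to be such that $L,M$ are quaternions: with $s=e^{i\rho}$, $s_i=e^{i\rho_i}$, the modulus of $l$ (for $i=1$), resp. $m$ (for $i=2$), is $$\sqrt{\frac{\cos(\rho_i-\arg\tan\frac{\delta_i}2)+\cos(\rho-\arg\tan\frac{\delta_i}2)}{\cos(\rho_i+\arg\tan\frac{\delta_i}2)+\cos(\rho+\arg\tan\frac{\delta_i}2)}},$$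 which equals $1$ when $\tan\frac{\delta_i}2$ is real. Edge-constraint net: two maps $f:\mathbb{Z}^2\to\mathbb{R}^3$, $n:\mathbb{Z}^2\to\mathbb{S}^2$ with $f_i-f\perp n_i+n$ for all edges ($i=1,2$). *)

(* Defs.v *)
From HB Require Import structures.
From mathcomp Require Import all_boot all_order all_algebra.
From mathcomp Require Import complex.
From mathcomp Require Import all_classical all_reals all_analysis.
From mathcomp Require Import ring.

Set Implicit Arguments.
Unset Strict Implicit.
Unset Printing Implicit Defensive.

Import Order.TTheory GRing.Theory Num.Theory.
Import numFieldNormedType.Exports.

Local Open Scope classical_set_scope.
Local Open Scope ring_scope.
Local Open Scope complex_scope.

Section ComplexTrigonometry.
Context {R : realType}.

Definition expi (r : R) : R[i] := cos r +i* sin r.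

Definition cexp (z : R[i]) : R[i] :=
  (expR (complex.Re z))%:C * expi (complex.Im z).

Definition ccos (z : R[i]) : R[i] := (cexp ('i%C * z) + cexp (- ('i%C * z))) / 2.
Definition csin (z : R[i]) : R[i] :=
  (cexp ('i%C * z) - cexp (- ('i%C * z))) / (2 * 'i%C).

Definition ctan (z : R[i]) : R[i] := csin z / ccos z.
Definition ccot (z : R[i]) : R[i] := ccos z / csin z.

End ComplexTrigonometry.

Section Quaternions.
Context {R : realType}.

Definition mx2 (a b c d : R[i]) : 'M[R[i]]_2 :=
  \matrix_(i < 2, j < 2)
    if i == 0 then (if j == 0 then a else b) else (if j == 0 then c else d).

Definition sigma1 : 'M[R[i]]_2 := mx2 0 1 1 0.
Definition sigma2 : 'M[R[i]]_2 := mx2 0 (- 'i%C) 'i%C 0.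
Definition sigma3 : 'M[R[i]]_2 := mx2 1 0 0 (- 1).

(* The identification of R^3 with the imaginary quaternions. *)
Definition imq (x : 'rV[R]_3) : 'M[R[i]]_2 :=
  (x 0 0)%:C *: (- 'i%C *: sigma1)
  + (x 0 1)%:C *: (- 'i%C *: sigma2)
  + (x 0 2)%:C *: (- 'i%C *: sigma3).

Lemma imqE (x : 'rV[R]_3) :
  imq x = mx2 (0 -i* x 0 2) ((- x 0 1) -i* x 0 0)
              (x 0 1 -i* x 0 0) (0 +i* x 0 2).
Proof.
apply/matrixP=> i j; rewrite /imq /sigma1 /sigma2 /sigma3 /mx2 !mxE.
case: i => [[|[|//]] Hi]; case: j => [[|[|//]] Hj] /=;
 simpc; congr Complex; ring.
Qed.

Lemma imq_inj : injective imq.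
Proof.
move=> x y; rewrite !imqE => /matrixP E.
have := E 0 0; have := E 0 1; rewrite !mxE /=.
move=> -[] /oppr_inj h1 /oppr_inj h0 [] /oppr_inj h2.
apply/rowP=> i; case: i => [[|[|[|//]]] Hi].
- by rewrite (_ : Ordinal Hi = 0) //; apply: val_inj.
- by rewrite (_ : Ordinal Hi = 1) //; apply: val_inj.
- by rewrite (_ : Ordinal Hi = 2) //; apply: val_inj.
Qed.

Definition is_quaternion (X : 'M[R[i]]_2) : Prop :=
  exists (a : R) (x : 'rV[R]_3), X = (a%:C)%:M + imq x.

Definition tracefree (X : 'M[R[i]]_2) : 'M[R[i]]_2 := X - (\tr X / 2)%:M.

End Quaternions.

Section Calculus.
Context {R : realType}.

(* The library has no real-variable calculus for functions with values in
   R[i], so derivatives are taken on real and imaginary parts of the entries. *)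
Definition dermx (F : R -> 'M[R[i]]_2) (t : R) : 'M[R[i]]_2 :=
  \matrix_(i < 2, j < 2)
    (derive1 (fun u => complex.Re (F u i j)) t
     +i* derive1 (fun u => complex.Im (F u i j)) t).

Definition smooth_pos (F : R -> 'M[R[i]]_2) : Prop :=
  forall (i j : 'I_2) (n : nat) (x : R), 0 < x ->
    derivable (derive1n n (fun u => complex.Re (F u i j))) x 1 /\
    derivable (derive1n n (fun u => complex.Im (F u i j))) x 1.

End Calculus.

Section Lax.
Context {R : realType}.

(* The common shape of L and M: [e] is the edge variable, [s] and [si] are the
   values at the two endpoints of the edge. *)
Definition lax_matrix (delta e s si : R[i]) (lambda : R) : 'M[R[i]]_2 :=
  let la := lambda%:C in
  mx2 (ccot (delta / 2) * (e / s) + ctan (delta / 2) * (e * si))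
      ('i%C * (la - s * si / la))
      ('i%C * (la - 1 / (la * s * si)))
      (ccot (delta / 2) * (s / e) + ctan (delta / 2) * (1 / (e * si))).

Definition lax_L (s l : int -> int -> R[i]) (delta1 : int -> R[i])
    (k h : int) (lambda : R) : 'M[R[i]]_2 :=
  lax_matrix (delta1 k) (l k h) (s k h) (s (k + 1) h) lambda.

Definition lax_M (s m : int -> int -> R[i]) (delta2 : int -> R[i])
    (k h : int) (lambda : R) : 'M[R[i]]_2 :=
  lax_matrix (delta2 h) (m k h) (s k h) (s k (h + 1)) lambda.

Definition admissible_parameter (delta : R[i]) : Prop :=
  [/\ complex.Im delta = 0, csin (delta / 2) != 0 & ccos (delta / 2) != 0]
  \/ (complex.Im (csin delta) = 0 /\ 1 < complex.Re (csin delta)).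

(* The modulus formula; [a] is any argument of tan (delta / 2).  The quotient is
   0 / 0 for some endpoint values (for instance si = - s), where the
   quaternion requirement in [lax_edge] is what remains. *)
Definition edge_modulus (delta e s si : R[i]) : Prop :=
  (complex.Im (ctan (delta / 2)) = 0 -> `|e| = 1) /\
  (forall r ri a : R,
     s = expi r -> si = expi ri ->
     ctan (delta / 2) = `|ctan (delta / 2)| * expi a ->
     cos (ri + a) + cos (r + a) != 0 ->
     `|e| = (Num.sqrt ((cos (ri - a) + cos (r - a))
                       / (cos (ri + a) + cos (r + a))))%:C).

Definition lax_edge (delta e s si : R[i]) : Prop :=
  [/\ admissible_parameter delta, e != 0, edge_modulus delta e s si
    & forall lambda : R, 0 < lambda ->
        is_quaternion (lax_matrix delta e s si lambda)].

(* [delta1] is constant in the second lattice direction and [delta2] in the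
   first, so each depends on one coordinate only. *)
Definition lax_data (s l m : int -> int -> R[i])
    (delta1 delta2 : int -> R[i]) : Prop :=
  forall k h : int,
    [/\ `|s k h| = 1,
        lax_edge (delta1 k) (l k h) (s k h) (s (k + 1) h)
      & lax_edge (delta2 h) (m k h) (s k h) (s k (h + 1))].

Definition integrable_lax (s l m : int -> int -> R[i])
    (delta1 delta2 : int -> R[i]) : Prop :=
  forall (k h : int) (lambda : R), 0 < lambda ->
    lax_M s m delta2 (k + 1) h lambda *m lax_L s l delta1 k h lambda
    = lax_L s l delta1 k (h + 1) lambda *m lax_M s m delta2 k h lambda.

End Lax.

Section EdgeConstraint.
Context {R : realType}.

Definition dot3 (u v : 'rV[R]_3) : R := \sum_(i < 3) u 0 i * v 0 i.

Definition edge_constraint_net (f n : int -> int -> 'rV[R]_3) : Prop :=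
  forall k h : int,
    [/\ dot3 (n k h) (n k h) = 1,
        dot3 (f (k + 1) h - f k h) (n (k + 1) h + n k h) = 0
      & dot3 (f k (h + 1) - f k h) (n k (h + 1) + n k h) = 0].

End EdgeConstraint.

(* Main.v *)
Require Import Defs.
From HB Require Import structures.
From mathcomp Require Import all_boot all_order all_algebra.
From mathcomp Require Import complex.
From mathcomp Require Import all_classical all_reals all_analysis.
From mathcomp Require Import ring lra.

Set Implicit Arguments.
Unset Strict Implicit.
Unset Printing Implicit Defensive.

Import Order.TTheory GRing.Theory Num.Theory.
Import numFieldNormedType.Exports.

Local Open Scope classical_set_scope.
Local Open Scope ring_scope.
Local Open Scope complex_scope.


(** Write [X' = dX/dt] and let [P] be the frame at the tail of an edge and [L P]
    the frame at its head.  Then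
      [f1 - f = 2 tracefree (P^-1 (L^-1 L') P)]  and
      [n1 + n = - i P^-1 (L^-1 sigma3 L + sigma3) P],
    because the two terms containing [P'] cancel.  On imaginary quaternions the
    Euclidean product is [-1/2] times the trace of the product, so conjugation
    by [P] disappears, and the edge constraint becomes
      [tr (L^-1 L' (L^-1 sigma3 L + sigma3)) = 0].
    The spectral parameter enters only the off-diagonal entries of a Lax matrix,
    so [L'] is off-diagonal and anticommutes with [sigma3].  Cyclicity of the
    trace turns the first summand [tr (L' L^-1 sigma3)] into
    [tr (L^-1 sigma3 L') = - tr (L^-1 L' sigma3)], the opposite of the second:
    this is [edge_trace].

    It remains to see that [f] and [n] really take values in R^3.  Quaternions
    are the matrices with [X J = J conj X] for a fixed [J] ([quaternionP]),
    hence they are closed under products and inverses, and the real-variable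
    derivative of a quaternion-valued curve is a quaternion
    ([is_quaternion_mxderive]).  Finally [n] has length 1 because it is
    conjugate to [- i sigma3], whose square is [-1]. *)

(** * Trace identities *)

Section MatrixTrace.
Variables (K : fieldType) (n : nat).
Implicit Types P L S : 'M[K]_n.

Lemma invmx_mulmx P L :
  L \in unitmx -> P \in unitmx -> invmx (L *m P) = invmx P *m invmx L.
Proof.
move=> uL uP; have uLP : L *m P \in unitmx by rewrite unitmx_mul uL.
apply: (can_inj (mulKmx uLP)).
by rewrite mulmxV// mulmxA mulmxK// mulmxV.
Qed.

Lemma mxtrace_conjg P X : P \in unitmx -> \tr (invmx P *m X *m P) = \tr X.
Proof. by move=> uP; rewrite -mulmxA mxtrace_mulC mulmxK. Qed.

(** [X := L^-1 L'] and [Y := L^-1 S L + S] satisfy [tr (X Y) = 0], the two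
    terms being opposite by cyclicity and anticommutation; the left-hand side
    is the trace of their conjugates by [P], since the logarithmic derivative of
    [L P] exceeds that of [P] by [P^-1 X P]. *)
Lemma edge_trace (P P' L L' S : 'M[K]_n) :
    P \in unitmx -> L \in unitmx -> L' *m S = - (S *m L') ->
  \tr ((invmx (L *m P) *m (L' *m P + L *m P') - invmx P *m P')
       *m (invmx (L *m P) *m S *m (L *m P) + invmx P *m S *m P)) = 0.
Proof.
move=> uP uL anti; rewrite invmx_mulmx//.
have -> : invmx P *m invmx L *m (L' *m P + L *m P') - invmx P *m P'
    = invmx P *m (invmx L *m L') *m P.
  by rewrite mulmxDr !mulmxA mulmxKV// addrK.
have -> : invmx P *m invmx L *m S *m (L *m P) + invmx P *m S *m P
    = invmx P *m (invmx L *m S *m L + S) *m P.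
  by rewrite mulmxDr mulmxDl !mulmxA.
have -> : invmx P *m (invmx L *m L') *m P
      *m (invmx P *m (invmx L *m S *m L + S) *m P)
    = invmx P *m (invmx L *m L' *m (invmx L *m S *m L + S)) *m P.
  by rewrite !mulmxA mulmxK.
rewrite mxtrace_conjg// mulmxDr mxtraceD.
have -> : invmx L *m L' *m (invmx L *m S *m L)
    = invmx L *m (L' *m (invmx L *m S)) *m L by rewrite !mulmxA.
rewrite mxtrace_conjg// mxtrace_mulC -!mulmxA anti mulmxN mulmxA.
by rewrite raddfN /= addrC addNr.
Qed.

End MatrixTrace.

(** * Quaternions as complex matrices *)

Section Quaternions.
Context {R : realType}.
Implicit Types X Y : 'M[R[i]]_2.

(** [X *m quatJ = quatJ *m map_mx conjc X] is the reality condition cutting the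
    quaternions out of the complex matrices; being multiplicative in [X], it
    makes the closure properties below formal. *)
Definition quatJ : 'M[R[i]]_2 := mx2 0 1 (- 1) 0.

Lemma mx2E X : X = mx2 (X 0 0) (X 0 1) (X 1 0) (X 1 1).
Proof.
apply/matrixP => i j; rewrite mxE.
by case: i => [[|[|//]] Hi]; case: j => [[|[|//]] Hj] /=;
  congr (X _ _); apply: val_inj.
Qed.

Lemma eq_mx2 X Y : X 0 0 = Y 0 0 -> X 0 1 = Y 0 1 -> X 1 0 = Y 1 0 ->
  X 1 1 = Y 1 1 -> X = Y.
Proof. by move=> h1 h2 h3 h4; rewrite (mx2E X) (mx2E Y) h1 h2 h3 h4. Qed.

Lemma mul_mx2 (a b c d a' b' c' d' : R[i]) :
  mx2 a b c d *m mx2 a' b' c' d' =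
  mx2 (a * a' + b * c') (a * b' + b * d') (c * a' + d * c') (c * b' + d * d').
Proof. by apply: eq_mx2; rewrite !mxE !big_ord_recl big_ord0 !mxE addr0. Qed.

Lemma mulmx2_entry X Y i j :
  (X *m Y) i j = X i 0 * Y 0 j + X i 1 * Y 1 j.
Proof.
rewrite mxE !big_ord_recl big_ord0 addr0.
by congr (_ + X _ _ * Y _ _); apply: val_inj.
Qed.

Lemma tr_mx2 X : \tr X = X 0 0 + X 1 1.
Proof.
rewrite /mxtrace !big_ord_recl big_ord0 addr0.
by congr (_ + X _ _); apply: val_inj.
Qed.

(** A left inverse of [imq]; on a general quaternion it is the imaginary
    part. *)
Definition quat_vec X : 'rV[R]_3 :=
  \row_(j < 3) [:: - complex.Im (X 0 1); - complex.Re (X 0 1);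
                   - complex.Im (X 0 0)]`_j.

Lemma quatJP X : X *m quatJ = quatJ *m map_mx conjc X <->
  X 1 0 = - (X 0 1)^* /\ X 1 1 = (X 0 0)^*.
Proof.
rewrite {1 2}(mx2E X) /quatJ.
have -> : map_mx conjc (mx2 (X 0 0) (X 0 1) (X 1 0) (X 1 1)) =
   mx2 (X 0 0)^* (X 0 1)^* (X 1 0)^* (X 1 1)^*.
  by apply: eq_mx2; rewrite !mxE.
rewrite !mul_mx2 !(mulr0, mulr1, mul0r, mul1r, add0r, addr0, mulrN1, mulN1r).
split=> [/matrixP E|[-> ->]].
  have := E 1 0; have := E 0 0; rewrite !mxE /= => h1 /oppr_inj ->.
  by rewrite -[X 1 0]conjcK -h1 rmorphN.
by apply: eq_mx2; rewrite !mxE //= ?rmorphN /= ?conjcK.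
Qed.

Lemma quat_vecK X : X *m quatJ = quatJ *m map_mx conjc X ->
  X = ((complex.Re (X 0 0))%:C)%:M + imq (quat_vec X).
Proof.
move=> /quatJP[h1 h2]; rewrite imqE.
by apply: eq_mx2; rewrite !mxE /= ?h1 ?h2; case: (X 0 0) (X 0 1) => [a b] [c d];
  simpc; rewrite ?opprK.
Qed.

Lemma quaternionP X :
  is_quaternion X <-> X *m quatJ = quatJ *m map_mx conjc X.
Proof.
split=> [[a [x ->]]|/quat_vecK ->]; last by do 2!eexists.
apply/quatJP; rewrite imqE !mxE /=; split; simpc => //.
Qed.

Lemma is_quaternion_mul X Y :
  is_quaternion X -> is_quaternion Y -> is_quaternion (X *m Y).
Proof.
move=> /quaternionP hX /quaternionP hY; apply/quaternionP.
by rewrite map_mxM -mulmxA hY !mulmxA hX.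
Qed.

(** The adjugate times [X] is [|X 0 0|^2 + |X 0 1|^2], a sum of four real
    squares that vanishes only at [X = 0]. *)
Lemma quaternion_unitmx X : is_quaternion X -> X != 0 -> X \in unitmx.
Proof.
move=> /quaternionP/quatJP[h1 h2] X0.
have [z [zX z0]] : exists z : R[i],
    X *m mx2 (X 0 0)^* (- X 0 1) (X 0 1)^* (X 0 0) = z%:M /\ z != 0.
  exists (X 0 0 * (X 0 0)^* + X 0 1 * (X 0 1)^*); split.
    rewrite {1}(mx2E X) mul_mx2 h1 h2.
    by apply: eq_mx2; rewrite !mxE /=; ring.
  apply: contra X0 => zeq0; apply/eqP; rewrite (mx2E X) h1 h2.
  case: (X 0 0) (X 0 1) zeq0 => [a b] [c d] /=; simpc.
  rewrite eq_complex /= => /andP[/eqP h _].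
  have a2 := sqr_ge0 a; have b2 := sqr_ge0 b.
  have c2 := sqr_ge0 c; have d2 := sqr_ge0 d.
  have [a0 b0 c0 d0] : [/\ a = 0, b = 0, c = 0 & d = 0].
    split; apply/eqP; rewrite -sqrf_eq0; apply/eqP; lra.
  by apply: eq_mx2; rewrite !mxE /= ?a0 ?b0 ?c0 ?d0 ?oppr0.
have : X *m (z^-1 *: mx2 (X 0 0)^* (- X 0 1) (X 0 1)^* (X 0 0)) = 1%:M.
  by rewrite -scalemxAr zX scale_scalar_mx mulVf.
by case/mulmx1_unit.
Qed.

Lemma is_quaternion_inv X : X \in unitmx ->
  is_quaternion X -> is_quaternion (invmx X).
Proof.
move=> uX /quaternionP hX; apply/quaternionP.
rewrite map_invmx.
have uX' : map_mx conjc X \in unitmx by rewrite map_unitmx.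
apply: (can_inj (mulKmx uX)); apply: (can_inj (mulmxK uX')).
by rewrite mulKVmx// -mulmxA -[_ *m _ *m map_mx _ _]mulmxA mulVmx// mulmx1.
Qed.

Lemma imq_quat_vec X : is_quaternion X -> imq (quat_vec X) = tracefree X.
Proof.
move=> /quaternionP hX; rewrite /tracefree [X in X - _]quat_vecK//.
rewrite tr_mx2; have /quatJP[_ ->] := hX.
by rewrite -ReJ_add addrAC subrr add0r.
Qed.

Lemma tracefree_id X : \tr X = 0 -> tracefree X = X.
Proof. by rewrite /tracefree => ->; rewrite mul0r raddf0 subr0. Qed.

Lemma mxtrace_sigma3_conjg X :
  X \in unitmx -> \tr (invmx X *m sigma3 *m X) = 0.
Proof. by move=> uX; rewrite mxtrace_conjg// tr_mx2 !mxE /= subrr. Qed.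

Lemma tracefreeB X Y : tracefree (X - Y) = tracefree X - tracefree Y.
Proof.
by rewrite /tracefree raddfB /= mulrBl raddfB /= opprD addrACA -opprD.
Qed.

Lemma mxtrace_tracefree_mul X Y :
  \tr Y = 0 -> \tr (tracefree X *m Y) = \tr (X *m Y).
Proof.
move=> trY0; rewrite /tracefree mulmxBl mul_scalar_mx raddfB /= linearZ /=.
by rewrite trY0 mulr0 subr0.
Qed.

Lemma imqB x y : imq (x - y) = imq x - imq y :> 'M[R[i]]_2.
Proof.
rewrite !imqE; apply: eq_mx2; rewrite !mxE; simpc; congr Complex; ring.
Qed.

Lemma imqN x : imq (- x) = - imq x :> 'M[R[i]]_2.
Proof.
by rewrite /imq !mxE !rmorphN /= !scaleNr !opprD.
Qed.

Lemma imqD x y : imq (x + y) = imq x + imq y :> 'M[R[i]]_2.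
Proof.
by have := imqB x (- y); rewrite !imqN !opprK.
Qed.

(** The scalar part of the product of two imaginary quaternions is minus their
    dot product, and the trace is twice the scalar part. *)
Lemma mxtrace_imq_mul (x y : 'rV[R]_3) :
  \tr (imq x *m imq y) = (- 2 * dot3 x y)%:C.
Proof.
rewrite !imqE mul_mx2 tr_mx2 !mxE /=.
have -> : dot3 x y = x 0 0 * y 0 0 + x 0 1 * y 0 1 + x 0 2 * y 0 2.
  rewrite /dot3 !big_ord_recr big_ord0 /= add0r.
  by congr (x _ _ * y _ _ + x _ _ * y _ _ + x _ _ * y _ _); apply: val_inj.
simpc; congr Complex; ring.
Qed.

End Quaternions.

(** * Derivatives of matrix-valued curves *)

Section Derivative.
Context {R : realType}.

Definition is_cderive (g : R -> R[i]) (t : R) (d : R[i]) : Prop :=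
  is_derive t 1 (fun u => complex.Re (g u)) (complex.Re d) /\
  is_derive t 1 (fun u => complex.Im (g u)) (complex.Im d).

Definition is_mxderive (F : R -> 'M[R[i]]_2) (t : R) (D : 'M[R[i]]_2) : Prop :=
  forall i j, is_cderive (fun u => F u i j) t (D i j).

Lemma is_cderive_cst (c : R[i]) t : is_cderive (fun=> c) t 0.
Proof. by split; exact: is_derive_cst. Qed.

Lemma is_cderiveD g h t d e : is_cderive g t d -> is_cderive h t e ->
  is_cderive (fun u => g u + h u) t (d + e).
Proof.
move=> [gR gI] [hR hI]; split; rewrite raddfD /=.
- rewrite (_ : (fun _ => _) =
      (fun u => complex.Re (g u)) \+ (fun u => complex.Re (h u))).
    exact: is_deriveD.
  by apply/funext => u /=; rewrite raddfD.
- rewrite (_ : (fun _ => _) =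
      (fun u => complex.Im (g u)) \+ (fun u => complex.Im (h u))).
    exact: is_deriveD.
  by apply/funext => u /=; rewrite raddfD.
Qed.

Lemma ReM (x y : R[i]) :
  complex.Re (x * y) =
  complex.Re x * complex.Re y - complex.Im x * complex.Im y.
Proof. by case: x; case: y. Qed.

Lemma ImM (x y : R[i]) :
  complex.Im (x * y) =
  complex.Re x * complex.Im y + complex.Im x * complex.Re y.
Proof. by case: x; case: y. Qed.

Lemma is_cderiveM g h t d e : is_cderive g t d -> is_cderive h t e ->
  is_cderive (fun u => g u * h u) t (d * h t + g t * e).
Proof.
move=> [gR gI] [hR hI]; split; rewrite raddfD /= ?ReM ?ImM.
- rewrite (_ : (fun _ => _) =
      (fun u => complex.Re (g u)) * (fun u => complex.Re (h u))
      - (fun u => complex.Im (g u)) * (fun u => complex.Im (h u)) ).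
    apply: is_derive_eq; rewrite /GRing.scale /=; ring.
  by apply/funext => u; exact: ReM.
- rewrite (_ : (fun _ => _) =
      (fun u => complex.Re (g u)) * (fun u => complex.Im (h u))
      + (fun u => complex.Im (g u)) * (fun u => complex.Re (h u)) ).
    apply: is_derive_eq; rewrite /GRing.scale /=; ring.
  by apply/funext => u; exact: ImM.
Qed.

Lemma is_cderiveN g t d :
  is_cderive g t d -> is_cderive (fun u => - g u) t (- d).
Proof.
move=> hg; have := is_cderiveM (is_cderive_cst (- 1) t) hg.
rewrite mul0r add0r mulN1r.
by under eq_fun do rewrite mulN1r.
Qed.

Lemma is_cderiveJ g t d :
  is_cderive g t d -> is_cderive (fun u => (g u)^*) t (d^*).
Proof.
move=> [gR gI]; split.
  rewrite (_ : (fun _ => _) = (fun u => complex.Re (g u))).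
    by case: (d) gR.
  by apply/funext => u; case: (g u).
rewrite (_ : (fun _ => _) = - (fun u => complex.Im (g u))).
  rewrite (_ : complex.Im _ = - complex.Im d); first exact: is_deriveN.
  by case: (d).
by apply/funext => u; rewrite fctE; case: (g u).
Qed.

Lemma is_cderive_unique g t d e :
  is_cderive g t d -> is_cderive g t e -> d = e.
Proof.
move=> [[_ dR] [_ dI]] [[_ eR] [_ eI]].
by case: d dR dI => ? ? /= <- <-; case: e eR eI => ? ? /= <- <-.
Qed.

Lemma is_mxderiveM F G t D E : is_mxderive F t D -> is_mxderive G t E ->
  is_mxderive (fun u => F u *m G u) t (D *m G t + F t *m E).
Proof.
move=> hF hG i j.
rewrite (_ : (fun _ => _) = (fun u => F u i 0 * G u 0 j + F u i 1 * G u 1 j)).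
  rewrite (_ : (D *m G t + F t *m E) i j = (D i 0 * G t 0 j + F t i 0 * E 0 j)
     + (D i 1 * G t 1 j + F t i 1 * E 1 j)).
    by apply: is_cderiveD; apply: is_cderiveM.
  by rewrite mxE !mulmx2_entry addrACA.
by apply/funext => u; rewrite mulmx2_entry.
Qed.

Lemma mxderive_dermx F t D : is_mxderive F t D -> dermx F t = D.
Proof.
move=> h; apply/matrixP => i j; rewrite mxE !derive1E.
by have [[_ ->] [_ ->]] := h i j; case: (D i j).
Qed.

Lemma is_mxderive_expR F t : smooth_pos F ->
  is_mxderive (fun u => F (expR u)) t (dermx (fun u => F (expR u)) t).
Proof.
move=> hF i j; have [/derivableP hR /derivableP hI] := hF i j 0 _ (expR_gt0 t).
rewrite !mxE; split => /=; rewrite derive1E; apply: derivableP.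
- by have [d _] := is_derive1_comp hR (is_derive_expR t); exact: d.
- by have [d _] := is_derive1_comp hI (is_derive_expR t); exact: d.
Qed.

Lemma is_cderive_expR t : is_cderive (fun u => (expR u)%:C) t (expR t)%:C.
Proof. by split; [exact: is_derive_expR|exact: is_derive_cst]. Qed.

Lemma is_cderive_expRV t :
  is_cderive (fun u => (expR u)%:C^-1) t (- (expR t)%:C^-1).
Proof.
rewrite (_ : (fun _ => _) = (fun u => (expR (- u))%:C)).
  rewrite -fmorphV -expRN -rmorphN; split => /=; last exact: is_derive_cst.
  apply: is_derive_eq. by rewrite mulrN1.
by apply/funext => u; rewrite expRN fmorphV.
Qed.

(** The reality conditions [X 1 0 = - conj (X 0 1)] and [X 1 1 = conj (X 0 0)]
    are real-linear, so they can be differentiated. *)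
Lemma is_quaternion_mxderive F t D : (forall u, is_quaternion (F u)) ->
  is_mxderive F t D -> is_quaternion D.
Proof.
move=> hF hD; apply/quaternionP/quatJP.
have E u := (quatJP _).1 ((quaternionP _).1 (hF u)); split.
- apply: is_cderive_unique (hD 1 0) _.
  under eq_fun do rewrite (E _).1.
  exact/is_cderiveN/is_cderiveJ/hD.
- apply: is_cderive_unique (hD 1 1) _.
  under eq_fun do rewrite (E _).2.
  exact/is_cderiveJ/hD.
Qed.

(** * The edge constraint *)

(** The diagonal entries do not involve the spectral parameter, so the
    derivative is off-diagonal, which for 2 x 2 matrices means anticommuting
    with [sigma3]. *)
Lemma is_mxderive_lax (delta e s si : R[i]) t : exists2 D : 'M[R[i]]_2,
  is_mxderive (fun u => lax_matrix delta e s si (expR u)) t D &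
  D *m sigma3 = - (sigma3 *m D).
Proof.
pose la := (expR t)%:C.
exists (mx2 0 ('i%C * (la + s * si / la))
            ('i%C * (la + (s * si)^-1 / la)) 0); last first.
  by rewrite /sigma3 !mul_mx2; apply: eq_mx2; rewrite !mxE /=; ring.
have hc := is_cderive_cst _ t.
have offdiag c :
    is_cderive (fun u => 'i%C * ((expR u)%:C - c / (expR u)%:C)) t
      ('i%C * (la + c / la)).
  rewrite (_ : (fun _ => _) =
      (fun u => 'i%C * ((expR u)%:C + - c * (expR u)%:C^-1))); last first.
    by apply/funext => u; rewrite mulNr.
  have := is_cderiveM (hc 'i%C) (is_cderiveD (is_cderive_expR t)
     (is_cderiveM (hc (- c)) (is_cderive_expRV t))).
  by rewrite !mul0r !add0r mulrNN.
have offdiag' : is_cderive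
    (fun u => 'i%C * ((expR u)%:C - 1 / ((expR u)%:C * s * si))) t
    ('i%C * (la + (s * si)^-1 / la)).
  under eq_fun do rewrite -mulrA invfM mul1r [_^-1 * _]mulrC.
  exact: offdiag.
move=> i j; rewrite /lax_matrix mxE; under eq_fun do rewrite mxE.
by case: ifP => _; case: ifP => _; rewrite ?mxE.
Qed.

(** One lemma serves both lattice directions, whose Lax matrices have the same
    shape.  The Lax matrix is invertible because the two frames are. *)
Lemma edge_constraint_edge (P P1 : R -> 'M[R[i]]_2) (delta e s si : R[i])
    (t : R) (f f1 n n1 : 'rV[R]_3) :
    P t \in unitmx -> P1 t \in unitmx ->
    is_mxderive P t (dermx P t) ->
    (forall u, P1 u = lax_matrix delta e s si (expR u) *m P u) ->
    imq f = 2 *: tracefree (invmx (P t) *m dermx P t) ->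
    imq f1 = 2 *: tracefree (invmx (P1 t) *m dermx P1 t) ->
    imq n = - 'i%C *: (invmx (P t) *m sigma3 *m P t) ->
    imq n1 = - 'i%C *: (invmx (P1 t) *m sigma3 *m P1 t) ->
  dot3 (f1 - f) (n1 + n) = 0.
Proof.
move=> uP uP1 dP P1E hf hf1 hn hn1.
have uL : lax_matrix delta e s si (expR t) \in unitmx.
  by move: uP1; rewrite P1E unitmx_mul => /andP[].
have [L' dL anti] := is_mxderive_lax delta e s si t.
have dP1 : dermx P1 t =
    L' *m P t + lax_matrix delta e s si (expR t) *m dermx P t.
  by rewrite (funext P1E); apply: mxderive_dermx; exact: is_mxderiveM.
have : \tr (imq (f1 - f) *m imq (n1 + n)) = 0 :> R[i].
  rewrite imqB imqD hf hf1 hn hn1 -scalerBr -scalerDr -scalemxAl -scalemxAr.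
  rewrite !mxtraceZ -[tracefree _ - _]tracefreeB.
  rewrite mxtrace_tracefree_mul; last first.
    by rewrite mxtraceD !mxtrace_sigma3_conjg// addr0.
  by rewrite dP1 !P1E edge_trace// !mulr0.
rewrite mxtrace_imq_mul => -[/eqP].
by rewrite mulf_eq0 oppr_eq0 pnatr_eq0 => /eqP.
Qed.

End Derivative.

Theorem theorem2p3 (R : realType)
    (s l m : int -> int -> R[i]) (delta1 delta2 : int -> R[i])
    (hlax : lax_data s l m delta1 delta2)
    (hint : integrable_lax s l m delta1 delta2)
    (Phi : int -> int -> R -> 'M[R[i]]_2)
    (hquat : forall (k h : int) (lambda : R), 0 < lambda ->
       is_quaternion (Phi k h lambda) /\ Phi k h lambda != 0)
    (hsmooth : forall k h : int, smooth_pos (Phi k h))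
    (hPhi1 : forall (k h : int) (lambda : R), 0 < lambda ->
       Phi (k + 1) h lambda = lax_L s l delta1 k h lambda *m Phi k h lambda)
    (hPhi2 : forall (k h : int) (lambda : R), 0 < lambda ->
       Phi k (h + 1) lambda = lax_M s m delta2 k h lambda *m Phi k h lambda)
    (t : R) :
  exists f n : int -> int -> 'rV[R]_3,
    [/\ forall k h : int,
          imq (f k h) =
          2 *: tracefree (invmx (Phi k h (expR t))
                          *m dermx (fun u => Phi k h (expR u)) t),
        forall k h : int,
          imq (n k h) =
          - 'i%C *: (invmx (Phi k h (expR t)) *m sigma3 *m Phi k h (expR t))
      & edge_constraint_net f n].
Proof.
pose P k h u := Phi k h (expR u).
have hP k h u : is_quaternion (P k h u) /\ P k h u != 0.
  exact: hquat (expR_gt0 u).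
have uP k h : P k h t \in unitmx.
  by have [] := hP k h t; exact: quaternion_unitmx.
have dP k h : is_mxderive (P k h) t (dermx (P k h) t).
  exact: is_mxderive_expR (hsmooth k h).
pose X k h := invmx (P k h t) *m dermx (P k h) t.
pose N k h := - 'i%C *: (invmx (P k h t) *m sigma3 *m P k h t).
have qX k h : is_quaternion (X k h).
  have [q _] := hP k h t.
  apply: is_quaternion_mul; first exact: is_quaternion_inv.
  by apply: is_quaternion_mxderive (dP k h) => u; have [] := hP k h u.
have qN k h : is_quaternion (N k h).
  have [q _] := hP k h t.
  (* The scalar goes to sigma3: - i sigma3 is a quaternion, sigma3 is not. *)
  rewrite /N scalemxAl scalemxAr; apply: is_quaternion_mul => //.
  apply: is_quaternion_mul; first exact: is_quaternion_inv.
  apply/quaternionP/quatJP; rewrite !mxE /=; simpc; by split.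
have trN k h : \tr (N k h) = 0.
  by rewrite /N mxtraceZ mxtrace_sigma3_conjg// mulr0.
(* quat_vec drops the real part of X, which is what tracefree removes. *)
pose f k h := 2 *: quat_vec (X k h).
pose n k h := quat_vec (N k h).
have fE k h : imq (f k h) = 2 *: tracefree (X k h).
  by rewrite /f scaler_nat mulr2n imqD imq_quat_vec// -mulr2n scaler_nat.
have nE k h : imq (n k h) = N k h by rewrite imq_quat_vec// tracefree_id.
exists f, n; split=> // k h; split.
- have : \tr (imq (n k h) *m imq (n k h)) = - 2 :> R[i].
    rewrite nE /N -scalemxAl -scalemxAr scalerA !mxtraceZ mulrNN.
    rewrite !mulmxA mulmxK// -[_ *m sigma3 *m sigma3]mulmxA mxtrace_conjg//.
    rewrite tr_mx2 /sigma3 mul_mx2 !mxE /=; simpc; congr Complex; ring.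
  rewrite mxtrace_imq_mul => /(congr1 (@complex.Re R)) /= h2.
  lra.
- by apply: (edge_constraint_edge (uP k h) (uP (k + 1) h)) => // u;
    apply: hPhi1; exact: expR_gt0.
- by apply: (edge_constraint_edge (uP k h) (uP k (h + 1))) => // u;
    apply: hPhi2; exact: expR_gt0.
Qed.
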